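(* Let $k\ge 3$, $n>3$, and let $f\in P_k^n$ depend essentially on all of its $n$ variables. If $f\in G_{2,k}^{n,-}$, then each identification minor of $f$ (i.e. each $f_{i\leftarrow j}$ with $i\neq j$) is a symmetric function with respect to its essential variables, i.e. its value is invariant under every permutation of its essential variables.
   Context: $K=\{0,1,\ldots,k-1\}$; $P_k^n$ is the set of all functions $K^n\to K$ in variables $x_1,\ldots,x_n$. A variable $x_i$ is essential in $g$ if changing only the $i$-th argument can change the value of $g$; $Ess(g)$ is the set of essential variables, $ess(g)=|Ess(g)|$. For $i\neq j$, $g_{i\leftarrow j}(a_1,\ldots,a_n)=g(a_1,\ldots,a_{i-1},a_j,a_{i+1},\ldots,a_n)$. $Min(g)$ is the set of all $g_{i\leftarrow j}$ with $i\neq j$ and $x_i,x_j\in Ess(g)$; $gap(g)=ess(g)-\max_{t\in Min(g)}ess(t)$. $G_{p,k}^m=\{f\in P_k^n: ess(f)=m,\ gap(f)=p\}$. $G_{p,k}^{n,-}$ is the set of $f\in G_{p,k}^n$ such that $x_v\notin Ess(f_{u\leftarrow v})$ for all $u\neq v$ in $\{1,\ldots,n\}$. *)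

(* Defs.v *)
From mathcomp Require Import all_boot all_fingroup.

Set Implicit Arguments.
Unset Strict Implicit.
Unset Printing Implicit Defensive.

(* P_k^n, with K = 'I_k; the variables x_1, ..., x_n are indexed by 'I_n. *)
Definition kfun (k n : nat) : predArgType :=
  {ffun {ffun 'I_n -> 'I_k} -> 'I_k}.

Section IdentificationMinors.

Variables k n : nat.
Implicit Types (g : kfun k n) (i j u v : 'I_n).

Definition essential g i : bool :=
  [exists a : {ffun 'I_n -> 'I_k}, exists b : {ffun 'I_n -> 'I_k},
     [forall j : 'I_n, (j != i) ==> (a j == b j)] && (g a != g b)].

Definition Ess g : {set 'I_n} := [set i | essential g i].

Definition ess g : nat := #|Ess g|.

(* minor g i j is g_{i <- j}. *)
Definition minor g i j : kfun k n :=
  [ffun a : {ffun 'I_n -> 'I_k} =>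
     g [ffun l : 'I_n => if l == i then a j else a l]].

Definition Min g : {set kfun k n} :=
  [set t | [exists i in Ess g, exists j in Ess g,
              (i != j) && (t == minor g i j)]].

(* The subtraction never truncates: Ess (minor g i j) is included in Ess g
   when i and j are in Ess g. If ess g < 2, then Min g is empty and the
   maximum is 0. *)
Definition gap g : nat := ess g - \max_(t in Min g) ess t.

Definition G (p m : nat) : {set kfun k n} :=
  [set f | (ess f == m) && (gap f == p)].

Definition Gminus (p : nat) : {set kfun k n} :=
  [set f in G p n | [forall u : 'I_n, forall v : 'I_n,
                       (u != v) ==> (v \notin Ess (minor f u v))]].

(* perm_on (Ess g) s says that s moves only indices in Ess g. *)
Definition symmetric_ess g : Prop :=
  forall s : {perm 'I_n}, perm_on (Ess g) s ->
  forall a : {ffun 'I_n -> 'I_k}, g [ffun i : 'I_n => a (s i)] = g a.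

End IdentificationMinors.

Arguments G : clear implicits.
Arguments Gminus : clear implicits.

(* Main.v *)
(** If [f] lies in [Gminus], its value at a point with two equal coordinates
    does not change when their common value does. Listing the coordinates
    [i, j, u, v] and then the rest, this gives
    [f(c,c,x,y,..) = f(x,x,x,y,..) = f(y,x,y,y,..) = f(x,x,y,x,..)
    = f(c,c,y,x,..)],
    so [minor f i j] is invariant under the transposition of any two variables
    other than [x_i] and [x_j]. Neither of these is essential in [minor f i j],
    and transpositions generate the permutations of the remaining variables. *)
Require Import Defs.
From mathcomp Require Import all_boot all_fingroup.

Section MinorSymmetry.

Variables k n : nat.
Implicit Types (f g : kfun k n) (a b : {ffun 'I_n -> 'I_k}) (i j u v : 'I_n).

Lemma not_essential_eq g i a b :
  i \notin Ess g -> (forall l, l != i -> a l = b l) -> g a = g b.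
Proof.
rewrite inE => nEi eq_ab; apply/eqP; apply: contraNT nEi => neq_g.
apply/existsP; exists a; apply/existsP; exists b; rewrite neq_g andbT.
by apply/forallP=> l; apply/implyP=> /eq_ab ->.
Qed.

Lemma minor_not_essential f i j : i != j -> i \notin Ess (minor f i j).
Proof.
move=> neq_ij; rewrite inE; apply/negP=> /existsP[a /existsP[b /andP[/forallP eq_ab]]].
case/eqP; rewrite !ffunE; congr (f _); apply/ffunP=> l; rewrite !ffunE.
have eq_abl m : m != i -> a m = b m by move=> nmi; apply/eqP/(implyP (eq_ab m)).
by case: eqVneq => [_|/eq_abl //]; apply: eq_abl; rewrite eq_sym.
Qed.

(** Where coordinates [i] and [j] agree, [f] coincides with [minor f i j], which depends on neither
    of them. *)
Lemma eq_common_value f i j a b :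
    i != j -> j \notin Ess (minor f i j) -> a i = a j -> b i = b j ->
    (forall l, l != i -> l != j -> a l = b l) ->
  f a = f b.
Proof.
move=> neq_ij nEj aij bij eq_ab.
have minorE (c : {ffun 'I_n -> 'I_k}) : c i = c j -> f c = minor f i j c.
  move=> cij; rewrite ffunE; congr (f _); apply/ffunP=> l; rewrite ffunE.
  by case: eqP => [->|].
rewrite !minorE //.
(* [c] differs from [a] at most at [j], and from [b] at most at [i]. *)
pose c : {ffun 'I_n -> 'I_k} := [ffun l => if l == i then a i else b l].
transitivity (minor f i j c).
  apply: not_essential_eq nEj _ => l nlj.
  by rewrite ffunE; case: eqVneq => [->|nli] //; apply: eq_ab.
apply: not_essential_eq (minor_not_essential f i j neq_ij) _ => l nli.
by rewrite ffunE (negbTE nli).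
Qed.

Lemma minor_tperm f i j u v a :
    (forall p q, p != q -> q \notin Ess (minor f p q)) ->
    uniq [:: i; j; u; v] ->
  minor f i j [ffun l => a (tperm u v l)] = minor f i j a.
Proof.
move=> fP; rewrite /= !inE !negb_or -!andbA.
case/and4P=> nij niu niv /and4P[nju njv nuv _].
pose w p q r s : {ffun 'I_n -> 'I_k} := [ffun l => if l == i then p else
  if l == j then q else if l == u then r else if l == v then s else a l].
have [nji nui nvi] : [/\ j != i, u != i & v != i] by rewrite !(eq_sym _ i).
have [nuj nvj nvu] : [/\ u != j, v != j & v != u].
  by rewrite !(eq_sym _ j) (eq_sym v u).
have wi p q r s : w p q r s i = p by rewrite ffunE eqxx.
have wj p q r s : w p q r s j = q by rewrite ffunE (negbTE nji) eqxx.
have wu p q r s : w p q r s u = r.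
  by rewrite ffunE (negbTE nui) (negbTE nuj) eqxx.
have wv p q r s : w p q r s v = s.
  by rewrite ffunE (negbTE nvi) (negbTE nvj) (negbTE nvu) eqxx.
have fwij c d r s : f (w c c r s) = f (w d d r s).
  apply: (@eq_common_value f i j); rewrite ?wi ?wj ?fP // => l nli nlj.
  by rewrite !ffunE (negbTE nli) (negbTE nlj).
have fwiu c d q s : f (w c q c s) = f (w d q d s).
  apply: (@eq_common_value f i u); rewrite ?wi ?wu ?fP // => l nli nlu.
  by rewrite !ffunE (negbTE nli) (negbTE nlu).
have fwiv c d q r : f (w c q r c) = f (w d q r d).
  apply: (@eq_common_value f i v); rewrite ?wi ?wv ?fP // => l nli nlv.
  by rewrite !ffunE (negbTE nli) (negbTE nlv).
set x := a u; set y := a v.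
have ->: minor f i j a = f (w (a j) (a j) x y).
  rewrite ffunE; congr (f _); apply/ffunP=> l; rewrite !ffunE.
  by case: eqP => // _; do 3![case: eqVneq => [->|_] //].
have ->: minor f i j [ffun l => a (tperm u v l)] = f (w (a j) (a j) y x).
  rewrite ffunE; congr (f _); apply/ffunP=> l; rewrite !ffunE.
  (* The transposition fixes [j], so the value copied into coordinate [i] is still [a j]. *)
  rewrite (tpermD nuj nvj).
  case: eqP => // _; case: eqVneq => [->|_]; first by rewrite tpermD.
  case: eqVneq => [->|nlu]; first by rewrite tpermL.
  case: eqVneq => [->|nlv]; first by rewrite tpermR.
  by rewrite tpermD // eq_sym.
(* Each change of a common value makes the next pair agree: the pairs are [i, j], then [i, v], then
   [i, u], then [i, j] again. *)
by rewrite (fwij _ x y x) (fwiv x y x y) (fwiu y x x y) (fwij x (a j)).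
Qed.

(** Induction on the number of moved points: each step splits off one transposition of two points of
    [A]. *)
Lemma tperm_invariant_perm_on g (A : {set 'I_n}) :
    {in A &, forall u v, u != v ->
       forall a, g [ffun l => a (tperm u v l)] = g a} ->
  forall s : {perm 'I_n}, perm_on A s -> forall a, g [ffun l => a (s l)] = g a.
Proof.
move=> gA s; have [m] := ubnP #|[set l | s l != l]|.
elim: m s => // m IHm s lt_s_m sA a.
have [x /= nsx | s_id] := pickP (fun x => s x != x); last first.
  congr (g _); apply/ffunP=> l; rewrite ffunE.
  by move/negbFE/eqP: (s_id l) => ->.
have Ax : x \in A by apply: (subsetP sA).
have Asx : s x \in A by rewrite (perm_closed x sA).
have nssx : s (s x) != s x by rewrite (inj_eq perm_inj).
(* [s'] moves strictly fewer points than [s], since it fixes [x]. *)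
pose s' := (s * tperm x (s x))%g.
have s'x : s' x = x by rewrite permM tpermR.
(* A fixed point of [s] is neither [x] nor [s x], so the transposition leaves it in place. *)
have s'_fix l : s l = l -> s' l = l.
  move=> sl; rewrite permM sl tpermD //.
    by apply: contraNneq nsx => ->; rewrite sl.
  by apply: contraNneq nssx => ->; rewrite sl.
have s'_moved l : s' l != l -> s l != l by apply: contraNneq => /s'_fix ->.
have lt_s' : #|[set l | s' l != l]| < m.
  rewrite -ltnS; apply: leq_trans lt_s_m; rewrite ltnS; apply/proper_card/properP.
  split; first by apply/subsetP=> l; rewrite !inE; apply: s'_moved.
  by exists x; rewrite inE // s'x eqxx.
have s'A : perm_on A s'.
  by apply/subsetP=> l /s'_moved nsl; apply: (subsetP sA).
have nxsx : x != s x by rewrite eq_sym.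
(* Transpositions are involutive, so following [s'] by [tperm x (s x)] gives back [s]. *)
rewrite -(gA x (s x) Ax Asx nxsx a) -(IHm s' lt_s' s'A [ffun l => a (tperm x (s x) l)]).
by congr (g _); apply/ffunP=> l; rewrite !ffunE permM tpermK.
Qed.

End MinorSymmetry.

Theorem theorem4p8 (k n : nat) (hk : 3 <= k) (hn : 3 < n) (f : kfun k n)
    (hess : Ess f = [set: 'I_n]) (hf : f \in Gminus k n 2) :
  forall i j : 'I_n, i != j -> symmetric_ess (minor f i j).
Proof.
have fP u v : u != v -> v \notin Ess (minor f u v).
  by move: hf; rewrite inE => /andP[_ /forallP/(_ u)/forallP/(_ v)/implyP].
move=> i j nij; apply: tperm_invariant_perm_on => u v Eu Ev nuv a.
(* [x_i] is inessential because it is overwritten, [x_j] because [f] lies in [Gminus]; so [u] and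
   [v] avoid both. *)
have nE l : l \in Ess (minor f i j) -> (i != l) && (j != l).
  move=> El; apply/andP; split; apply: contraTneq El => <-; last exact: fP.
  exact: minor_not_essential.
apply: minor_tperm fP _.
by case/andP: (nE u Eu) (nE v Ev) => niu nju /andP[niv njv]; rewrite /= !inE !negb_or nij niu niv nju njv nuv.
Qed.
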